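(* For every connected $P_5$-free graph $G$, $\gamma(G)=\tau_{ST}(G)$.
   Context: All graphs are finite and simple. $P_5$ is the path on five vertices; a graph is $P_5$-free if it has no induced subgraph isomorphic to $P_5$. $\gamma(G)$ denotes the domination number of $G$, i.e. the minimum size of a set $D\subseteq V(G)$ such that every vertex not in $D$ has a neighbor in $D$. For a connected graph $G$, $\tau_{ST}(G)$ denotes the minimum, over all spanning trees $T$ of $G$, of the size of a minimum vertex cover of $T$.
   Formalization: The graph is assumed to have at least two vertices, because for the one-vertex graph the domination number is 1 while its only spanning tree has no edges and so a minimum vertex cover of size 0. *)

(* Defs.v *)
From mathcomp Require Import all_boot.

Set Implicit Arguments.
Unset Strict Implicit.
Unset Printing Implicit Defensive.

(* A finite simple graph is a finType V with a symmetric irreflexive e : rel V. *)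

Definition connected (V : finType) (e : rel V) : bool :=
  [forall x, forall y, connect e x y].

(* A cycle has at least three vertices; [acyclicP] shows that restricting to
   lists of length at most #|V| loses nothing. *)
Definition acyclic (V : finType) (e : rel V) : bool :=
  [forall n : 'I_#|V|.+1, forall c : n.-tuple V, (2 < n) ==> ~~ ucycleb e c].

Lemma acyclicP (V : finType) (e : rel V) :
  reflect (forall c : seq V, 2 < size c -> ~ ucycle e c) (acyclic e).
Proof.
apply: (iffP forallP) => [ac c c3 uc | ac n].
  have cV : size c < #|V|.+1.
    by case/andP: uc => _ /card_uniqP <-; rewrite ltnS max_card.
  have /forallP/(_ (in_tuple c))/implyP/(_ c3) := ac (Ordinal cV).
  by rewrite (uc : ucycleb e c).
apply/forallP => c; apply/implyP => n3; apply/negP => uc.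
by apply: (ac c) => //; rewrite size_tuple.
Qed.

Definition path_graph (n : nat) : rel 'I_n :=
  [rel i j : 'I_n | (i.+1 == j :> nat) || (j.+1 == i :> nat)].

Definition induced_subgraph (U V : finType) (h : rel U) (e : rel V) : Prop :=
  exists f : U -> V, injective f /\ forall x y, e (f x) (f y) = h x y.

Definition P5_free (V : finType) (e : rel V) : Prop :=
  ~ induced_subgraph (@path_graph 5) e.

Definition dominating (V : finType) (e : rel V) (D : {set V}) : bool :=
  [forall x, (x \notin D) ==> [exists y in D, e x y]].

Definition vertex_cover (V : finType) (e : rel V) (C : {set V}) : bool :=
  [forall x, forall y, e x y ==> (x \in C) || (y \in C)].

(* In the two minima below, the default set [set: V] is itself admissible. *)
Definition domination_number (V : finType) (e : rel V) : nat :=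
  #|[arg min_(D < [set: V] | dominating e D) #|D|]|.

Definition vertex_cover_number (V : finType) (e : rel V) : nat :=
  #|[arg min_(C < [set: V] | vertex_cover e C) #|C|]|.

Definition edges (V : finType) (e : rel V) : {set {set V}} :=
  [set [set p.1; p.2] | p : V * V & e p.1 p.2].

Definition edge_rel (V : finType) (F : {set {set V}}) : rel V :=
  [rel x y | [set x; y] \in F].

Definition spanning_tree (V : finType) (e : rel V) (F : {set {set V}}) : bool :=
  [&& F \subset edges e, connected (edge_rel F) & acyclic (edge_rel F)].

(* The default #|V| bounds every vertex cover number, so this is the true
   minimum as soon as a spanning tree exists, i.e. when e is connected. *)
Definition tau_ST (V : finType) (e : rel V) : nat :=
  \big[minn/#|V|]_(F : {set {set V}} | spanning_tree e F)
    vertex_cover_number (edge_rel F).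

(* Main.v *)
(* Call an edge D-incident if it has an endpoint in D.  If a dominating set D is
   such that the D-incident edges connect G, then any spanning tree made of such
   edges is covered by D.  So it is enough to find a minimum dominating set with
   this property; take one for which the D-incident edges connect as many pairs
   of vertices as possible.  If they do not connect G, some edge a b of G joins
   two of their components, and a, b have neighbors x, y in D.  Then x a b y is
   an induced path, and P5-freeness forces N[x] and N[y] into the union of N[a]
   and N[b].  Hence replacing x, y by a, b keeps D a minimum dominating set, all
   connections are preserved, and a, b become connected: a contradiction. *)
Require Import Defs.
From mathcomp Require Import all_boot.

Set Implicit Arguments.
Unset Strict Implicit.
Unset Printing Implicit Defensive.

(** * Edge sets, domination and vertex covers *)

Lemma eq_set2P (T : finType) (x y u v : T) :
  [set x; y] = [set u; v] -> (x = u /\ y = v) \/ (x = v /\ y = u).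
Proof.
move=> E.
have := set21 x y; have := set22 x y; rewrite E !inE.
have := set21 u v; have := set22 u v; rewrite -E !inE.
by do 4![case/orP=> /eqP ?]; subst; auto.
Qed.

Lemma mem_edges (V : finType) (e : rel V) (x y : V) :
  symmetric e -> ([set x; y] \in edges e) = e x y.
Proof.
move=> e_sym; apply/imsetP/idP => [[[u v]]|exy].
  by rewrite inE /= => euv /eq_set2P[[-> ->]|[-> ->]] //; rewrite e_sym.
by exists (x, y); rewrite ?inE.
Qed.

Lemma edge_relE (V : finType) (F : {set {set V}}) (x y : V) :
  edge_rel F x y = ([set x; y] \in F).
Proof. by []. Qed.

Lemma edge_rel_sym (V : finType) (F : {set {set V}}) : symmetric (edge_rel F).
Proof. by move=> x y; rewrite !edge_relE setUC. Qed.

Lemma edge_rel_edges (V : finType) (e : rel V) :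
  symmetric e -> edge_rel (edges e) =2 e.
Proof. by move=> e_sym x y; rewrite edge_relE mem_edges. Qed.

Lemma connectedP (V : finType) (e : rel V) :
  reflect (forall x y, connect e x y) (connected e).
Proof.
by apply: (iffP forallP) => H x; [apply/forallP | apply/forallP=> y].
Qed.

Lemma dominatingP (V : finType) (e : rel V) (D : {set V}) :
  reflect (forall x, x \notin D -> exists2 y, y \in D & e x y)
          (dominating e D).
Proof.
apply: (iffP forallP) => H x.
  by move=> xD; have /implyP/(_ xD)/exists_inP := H x.
by apply/implyP=> xD; apply/exists_inP; apply: H.
Qed.

Lemma vertex_coverP (V : finType) (e : rel V) (C : {set V}) :
  reflect (forall x y, e x y -> (x \in C) || (y \in C)) (vertex_cover e C).
Proof.
apply: (iffP forallP) => H x; last by apply/forallP=> y; apply/implyP/H.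
by move=> y; have /forallP/(_ y)/implyP := H x.
Qed.

Lemma dominatingT (V : finType) (e : rel V) : dominating e [set: V].
Proof. by apply/dominatingP=> x; rewrite inE. Qed.

Lemma vertex_coverT (V : finType) (e : rel V) : vertex_cover e [set: V].
Proof. by apply/vertex_coverP=> x y; rewrite inE. Qed.

Lemma domination_number_leq (V : finType) (e : rel V) (D : {set V}) :
  dominating e D -> domination_number e <= #|D|.
Proof.
rewrite /domination_number; case: arg_minnP => [|D0 _ le_D0]; last exact: le_D0.
exact: dominatingT.
Qed.

Lemma domination_number_witness (V : finType) (e : rel V) :
  exists2 D, dominating e D & #|D| = domination_number e.
Proof.
rewrite /domination_number; case: arg_minnP => [|D dD _]; last by exists D.
exact: dominatingT.
Qed.

Lemma vertex_cover_number_leq (V : finType) (e : rel V) (C : {set V}) :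
  vertex_cover e C -> vertex_cover_number e <= #|C|.
Proof.
rewrite /vertex_cover_number.
case: arg_minnP => [|C0 _ le_C0]; last exact: le_C0.
exact: vertex_coverT.
Qed.

Lemma vertex_cover_number_witness (V : finType) (e : rel V) :
  exists2 C, vertex_cover e C & #|C| = vertex_cover_number e.
Proof.
rewrite /vertex_cover_number; case: arg_minnP => [|C cC _]; last by exists C.
exact: vertex_coverT.
Qed.

(** As [minn] has no neutral element on [nat], the bound is proved by induction along the
    enumeration of the edge sets. *)
Lemma tau_ST_leq (V : finType) (e : rel V) (F : {set {set V}}) :
  spanning_tree e F -> tau_ST e <= vertex_cover_number (edge_rel F).
Proof.
rewrite /tau_ST => stF; have := mem_index_enum F.
elim: (index_enum _) => // G s IHs; rewrite inE big_cons.
case/orP=> [/eqP <-|/IHs le_s]; first by rewrite stF geq_minl.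
by case: ifP => // _; rewrite geq_min le_s orbT.
Qed.

(** * Covers of spanning trees dominate *)

Lemma connected_neighbor (V : finType) (e : rel V) (x : V) :
  1 < #|V| -> connected e -> exists y, e x y.
Proof.
move=> V_gt1 /connectedP e_conn.
have /card_gt0P[y] : 0 < #|[set~ x]| by rewrite cardsC1 -subn1 subn_gt0.
rewrite !inE => /eqP y_neq_x; have /connectP[[|z p] /=] := e_conn x y.
  by move=> _ /y_neq_x.
by case/andP=> exz _ _; exists z.
Qed.

(** Each vertex has a neighbor, and the edge to it is covered. On a single vertex without edges the
    empty set is a cover but does not dominate; hence [1 < #|V|]. *)
Lemma cover_dominating (V : finType) (e : rel V) (C : {set V}) :
  1 < #|V| -> connected e -> vertex_cover e C -> dominating e C.
Proof.
move=> V_gt1 e_conn /vertex_coverP cov; apply/dominatingP=> x xC.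
have [y exy] := connected_neighbor x V_gt1 e_conn.
by exists y => //; have := cov _ _ exy; rewrite (negPf xC).
Qed.

Lemma dominating_sub (V : finType) (e e' : rel V) (D : {set V}) :
  subrel e' e -> dominating e' D -> dominating e D.
Proof.
move=> sub /dominatingP domD; apply/dominatingP=> x xD.
by have [y yD /sub exy] := domD x xD; exists y.
Qed.

Lemma domination_leq_tau_ST (V : finType) (e : rel V) :
  symmetric e -> 1 < #|V| -> domination_number e <= tau_ST e.
Proof.
move=> e_sym V_gt1; rewrite /tau_ST.
elim/big_ind: _ => [|m n le_m le_n|F /and3P[/subsetP Fe F_conn _]].
(* The default value [#|V|] of the minimum is the size of the full, dominating set. *)
- by rewrite -cardsT domination_number_leq ?dominatingT.
- by rewrite leq_min le_m.
have [C covC <-] := vertex_cover_number_witness (edge_rel F).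
apply: domination_number_leq; apply: dominating_sub (cover_dominating _ _ covC).
- by move=> x y /Fe; rewrite mem_edges.
- exact: V_gt1.
- exact: F_conn.
Qed.

(** * Existence of spanning trees *)

(** The rest of the cycle leads from [y] back to [x]. For empty [p] the way back would be the
    deleted edge itself, so [p] must be nonempty. *)
Lemma cycle_bypass (V : finType) (F : {set {set V}}) (x y : V) (p : seq V) :
    p != [::] -> ucycle (edge_rel F) [:: x, y & p] ->
  connect (edge_rel (F :\ [set x; y])) y x.
Proof.
case: p => // z p _ /andP[/= /and3P[_ Fyz pF]].
rewrite !inE !negb_or => /and3P[/and3P[xy xz xp] /andP[yz yp] _].
apply: (@connect_trans _ _ z).
  rewrite connect1 // edge_relE !inE -edge_relE Fyz andbT.
  apply/eqP=> /eq_set2P.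
  by case=> -[E1 E2]; [rewrite E1 eqxx in xy | rewrite E2 eqxx in xz].
apply/connectP; exists (rcons p x); last by rewrite last_rcons.
(* After its first edge the way back avoids [y], so it never uses the edge [[set x; y]]. *)
have: all (predC1 y) (z :: rcons p x).
  by rewrite /= eq_sym yz all_rcons /= xy -has_pred1 -all_predC in yp *.
move=> p_y; apply: (sub_in_path _ p_y pF) => u v.
rewrite !inE => /eqP uy /eqP vy; rewrite !edge_relE !inE => ->; rewrite andbT.
by apply/eqP=> /eq_set2P[[_ /vy]|[/uy]].
Qed.

(** An inclusion-minimal connected set of edges is acyclic: an edge of a cycle could be deleted
    without disconnecting it. *)
Lemma spanning_tree_exists (V : finType) (e : rel V) :
  symmetric e -> irreflexive e -> connected e -> exists F, spanning_tree e F.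
Proof.
move=> e_sym e_irr e_conn.
pose P (F : {set {set V}}) := (F \subset edges e) && connected (edge_rel F).
have P_edges : P (edges e).
  rewrite /P subxx; apply/connectedP=> x y.
  by rewrite (eq_connect (edge_rel_edges e_sym)); apply/connectedP.
have [F /minsetP[/andP[Fe F_conn] F_min] _] := minset_exists P_edges.
exists F; apply/and3P; split=> //.
apply/acyclicP => -[|x [|y p]] // c_gt2 c_cyc.
have Fxy : [set x; y] \in F by case/andP: c_cyc => /andP[].
have by_pass : connect (edge_rel (F :\ [set x; y])) y x.
  by apply: cycle_bypass c_cyc; case: p c_gt2.
suff: P (F :\ [set x; y]).
  by move=> /F_min/(_ (subD1set _ _)) E; rewrite -E !inE eqxx in Fxy.
rewrite /P (subset_trans (subD1set _ _) Fe) /=; apply/connectedP=> u v.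
have /connectedP/(_ u v) := F_conn; apply: connect_sub u v => u v Fuv.
have [/eq_set2P[[-> ->]|[-> ->]]|uv_neq] := [set u; v] =P [set x; y] => //.
  by rewrite (sym_connect_sym (@edge_rel_sym _ _)).
by apply: connect1; rewrite edge_relE !inE -edge_relE Fuv andbT; apply/eqP.
Qed.

(** * Edges incident to a vertex set *)

Definition incident_rel (V : finType) (e : rel V) (D : {set V}) : rel V :=
  [rel x y | e x y && ((x \in D) || (y \in D))].

Lemma incident_relE (V : finType) (e : rel V) (D : {set V}) (x y : V) :
  incident_rel e D x y = e x y && ((x \in D) || (y \in D)).
Proof. by []. Qed.

Lemma incident_rel_sym (V : finType) (e : rel V) (D : {set V}) :
  symmetric e -> symmetric (incident_rel e D).
Proof. by move=> e_sym x y; rewrite !incident_relE e_sym orbC. Qed.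

(** A spanning tree of [incident_rel e D] is also one of [e], and [D] covers all its edges. *)
Lemma tau_ST_leq_incident (V : finType) (e : rel V) (D : {set V}) :
    symmetric e -> irreflexive e -> connected (incident_rel e D) ->
  tau_ST e <= #|D|.
Proof.
move=> e_sym e_irr D_conn; have eD_sym := incident_rel_sym D e_sym.
have eD_irr : irreflexive (incident_rel e D).
  by move=> x; rewrite incident_relE e_irr.
have [F /and3P[FD F_conn F_ac]] := spanning_tree_exists eD_sym eD_irr D_conn.
apply: leq_trans (@tau_ST_leq _ _ F _) (vertex_cover_number_leq _).
  apply/and3P; split=> //; apply: subset_trans FD _; apply: imsetS.
  by apply/subsetP=> -[x y]; rewrite !inE => /andP[].
apply/vertex_coverP=> x y /(subsetP FD).
by rewrite (mem_edges _ _ eD_sym) => /andP[].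
Qed.

(** * Chords forced by P5-freeness *)

(** Stated for walks: if there is no chord, [f] preserves adjacency and non-adjacency, and its
    injectivity follows from this. *)
Lemma P5_free_path (V : finType) (e : rel V) (v1 v2 v3 v4 v5 : V) :
    symmetric e -> irreflexive e -> P5_free e ->
    e v1 v2 -> e v2 v3 -> e v3 v4 -> e v4 v5 ->
  [|| e v1 v3, e v1 v4, e v1 v5, e v2 v4, e v2 v5 | e v3 v5].
Proof.
move=> e_sym e_irr P5 e12 e23 e34 e45; apply: contraT.
rewrite !negb_or => /and5P[/negPf n13 /negPf n14 /negPf n15 /negPf n24].
case/andP=> /negPf n25 /negPf n35.
pose f (i : 'I_5) := nth v1 [:: v1; v2; v3; v4; v5] i.
have f_adj x y : e (f x) (f y) = path_graph x y.
  case: x y => -[|[|[|[|[|//]]]]] ? [[|[|[|[|[|//]]]]] ?];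
    by rewrite /path_graph /f /= ?e_irr // e_sym.
case: P5; exists f; split=> // x y fxy.
(* No two vertices of P5 have the same neighborhood. *)
have nbh z : path_graph x z = path_graph y z by rewrite -!f_adj fxy.
apply/val_inj; move: (nbh (inord 0)) (nbh (inord 1)) (nbh (inord 2)).
move: (nbh (inord 3)) (nbh (inord 4)); rewrite /path_graph /= !inordK //.
by case: x y {nbh fxy} => -[|[|[|[|[|//]]]]] ? [[|[|[|[|[|//]]]]] ?].
Qed.

(** The walk [z], [x], [a], [b], [y] has a chord. Each of the chords [x b], [x y], [a y], [z y]
    would connect [a] to [b] by [D]-incident edges, so the chord is [z a] or [z b]. *)
Lemma neighbor_exchange (V : finType) (e : rel V) (D : {set V})
    (a b x y z : V) :
    symmetric e -> irreflexive e -> P5_free e ->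
    ~~ connect (incident_rel e D) a b -> e a b ->
    x \in D -> y \in D -> e a x -> e b y -> e x z ->
  e z a || e z b || (z == a).
Proof.
move=> e_sym e_irr P5 ab_sep eab xD yD eax eby exz.
have Dab u v : e u v -> (u \in D) || (v \in D) ->
    connect (incident_rel e D) u v by move=> *; apply/connect1/andP.
have ax : connect (incident_rel e D) a x by apply: Dab; rewrite ?xD ?orbT.
have yb : connect (incident_rel e D) y b.
  by apply: Dab; rewrite ?yD // e_sym.
have xb : e x b = false.
  apply: contraNF ab_sep => exb; apply: connect_trans ax (Dab _ _ exb _).
  by rewrite xD.
have xy : e x y = false.
  apply: contraNF ab_sep => exy; apply: connect_trans ax _.
  by apply: connect_trans yb; apply: Dab exy _; rewrite xD.
have ay : e a y = false.
  apply: contraNF ab_sep => eay; apply: connect_trans yb.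
  by apply: Dab eay _; rewrite yD orbT.
have zy : e z y = false.
  apply: contraNF ab_sep => ezy; apply: connect_trans ax _.
  apply: connect_trans yb; apply: (@connect_trans _ _ z).
    by apply: Dab exz _; rewrite xD.
  by apply: Dab ezy _; rewrite yD orbT.
have ezx : e z x by rewrite e_sym.
have exa : e x a by rewrite e_sym.
have := P5_free_path e_sym e_irr P5 ezx exa eab eby.
by rewrite xb xy ay zy !orbF => ->.
Qed.

(** * Exchanging two vertices of a dominating set *)

Definition exchange (V : finType) (D : {set V}) (a b x y : V) : {set V} :=
  [set a; b] :|: (D :\: [set x; y]).

Lemma card_exchange (V : finType) (D : {set V}) (a b x y : V) :
  x != y -> x \in D -> y \in D -> #|exchange D a b x y| <= #|D|.
Proof.
move=> xy xD yD; have xyD : [set x; y] \subset D.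
  by apply/subsetP=> z; rewrite !inE => /orP[]/eqP->.
rewrite (leq_trans (leq_card_setU _ _)) // (cardsD D) (setIidPr xyD).
have := subset_leq_card xyD; rewrite !cards2 xy => D2.
by rewrite -[leqRHS](subnKC D2) leq_add2r; case: (a != b).
Qed.

(** The hypothesis says that N[x] and N[y] lie in the union of N[a] and N[b]; a vertex that loses
    its dominator [x] or [y] is therefore dominated by [a] or [b]. *)
Lemma dominating_exchange (V : finType) (e : rel V) (D : {set V})
    (a b x y : V) :
    (forall z, z \in [set x; y] \/ e z x \/ e z y ->
      [|| z \in [set a; b], e z a | e z b]) ->
  dominating e D -> dominating e (exchange D a b x y).
Proof.
move=> nbh /dominatingP domD; apply/dominatingP=> z zD'.
have z_ab : z \notin [set a; b].
  by apply: contra zD' => z_ab; rewrite in_setU z_ab.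
have near_ab : e z a || e z b -> exists2 w, w \in exchange D a b x y & e z w.
  by case/orP=> [eza|ezb]; [exists a | exists b]; rewrite // !inE eqxx ?orbT.
have [z_xy|z_xy] := boolP (z \in [set x; y]).
  by apply: near_ab; have := nbh z (or_introl z_xy); rewrite (negPf z_ab).
have zD : z \notin D by move: zD'; rewrite in_setU in_setD z_xy (negPf z_ab).
have [w wD ezw] := domD z zD.
have [w_xy|w_xy] := boolP (w \in [set x; y]); last first.
  by exists w => //; rewrite in_setU in_setD w_xy wD orbT.
apply: near_ab; have := nbh z; rewrite (negPf z_ab); apply; right.
by move: w_xy ezw; rewrite !inE => /orP[]/eqP->; auto.
Qed.

(** As [a] and [b] are adjacent and belong to [D'], the union of N[a] and N[b] lies in one new
    component. It contains both ends of every edge at [x] or [y]; the other [D]-incident edges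
    remain [D']-incident. *)
Lemma connect_exchange (V : finType) (e : rel V) (D : {set V}) (a b x y : V) :
    symmetric e -> e a b ->
    (forall z, z \in [set x; y] \/ e z x \/ e z y ->
      [|| z \in [set a; b], e z a | e z b]) ->
  subrel (connect (incident_rel e D))
         (connect (incident_rel e (exchange D a b x y))).
Proof.
move=> e_sym eab nbh; set D' := exchange D a b x y.
have csym := sym_connect_sym (incident_rel_sym D' e_sym).
have aD' : a \in D' by rewrite !inE eqxx.
have bD' : b \in D' by rewrite !inE eqxx orbT.
have ba : connect (incident_rel e D') b a.
  by rewrite connect1 // incident_relE e_sym eab aD' orbT.
have to_a z : z \in [set x; y] \/ e z x \/ e z y ->
    connect (incident_rel e D') z a.
  case/nbh/or3P => [|eza|ezb].
  - by rewrite !inE => /orP[]/eqP->.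
  - by rewrite connect1 // incident_relE eza aD' orbT.
  by apply: connect_trans ba; rewrite connect1 // incident_relE ezb bD' orbT.
have step u v : e u v -> u \in D -> connect (incident_rel e D') u v.
  move=> euv uD; have [u_xy|u_xy] := boolP (u \in [set x; y]); last first.
    by rewrite connect1 // incident_relE euv in_setU in_setD u_xy uD orbT.
  apply: connect_trans (to_a u (or_introl u_xy)) _; rewrite csym; apply: to_a.
  by right; move: u_xy euv; rewrite !inE e_sym => /orP[]/eqP->; auto.
apply: connect_sub => u v /andP[euv /orP[uD|vD]]; first exact: step.
by rewrite csym; apply: step; rewrite // e_sym.
Qed.

(** * The extremal dominating set *)

(** If every edge of [e] stayed inside a component of [r], so would every path of [e]. *)
Lemma disconnected_edge (V : finType) (e r : rel V) :
    connected e -> ~~ connected r ->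
  exists a b, e a b /\ ~~ connect r a b.
Proof.
move=> e_conn r_disc.
have [[a b] /andP[eab rab]|no_edge] :=
    pickP (fun p : V * V => e p.1 p.2 && ~~ connect r p.1 p.2).
  by exists a, b.
case/negP: r_disc; apply/connectedP=> u v.
have /connectedP/(_ u v) := e_conn; apply: connect_sub u v => a b eab.
by have /negbT := no_edge (a, b); rewrite /= eab negbK.
Qed.

(** The size of this set, taken for the [D]-incident edges, is the quantity to be maximized. *)
Definition connected_pairs (V : finType) (e : rel V) : {set V * V} :=
  [set p | connect e p.1 p.2].

Lemma improve_dominating (V : finType) (e : rel V) (D : {set V}) :
    symmetric e -> irreflexive e -> connected e -> P5_free e ->
    dominating e D -> ~~ connected (incident_rel e D) ->
  exists2 D', dominating e D' /\ #|D'| <= #|D| &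
    #|connected_pairs (incident_rel e D)|
      < #|connected_pairs (incident_rel e D')|.
Proof.
move=> e_sym e_irr e_conn P5 domD.
case/(disconnected_edge e_conn) => a [b [eab ab_sep]].
have ba_sep : ~~ connect (incident_rel e D) b a.
  by rewrite (sym_connect_sym (incident_rel_sym D e_sym)).
have eba : e b a by rewrite e_sym.
have inc u v : e u v -> (u \in D) || (v \in D) ->
    connect (incident_rel e D) u v by move=> *; apply/connect1/andP.
(* Otherwise the edge [a b] would itself be [D]-incident. *)
have /norP[aD bD] : ~~ ((a \in D) || (b \in D)).
  by apply: contra ab_sep; apply: inc.
have /dominatingP dom := domD.
have [[x xD eax] [y yD eby]] := (dom a aD, dom b bD).
(* A common neighbor in [D] would connect [a] to [b]. Distinctness keeps the exchange from enlarging
   [D]: two vertices leave and at most two enter. *)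
have xy : x != y.
  apply: contraNneq ab_sep => xy; apply: (@connect_trans _ _ x).
    by apply: inc; rewrite ?xD ?orbT.
  by apply: inc; rewrite ?xD // xy e_sym.
have nbh z : z \in [set x; y] \/ e z x \/ e z y ->
    [|| z \in [set a; b], e z a | e z b].
  rewrite !inE; case=> [/orP[]/eqP->|[]].
  - by rewrite (e_sym x a) eax !orbT.
  - by rewrite (e_sym y b) eby !orbT.
  - rewrite e_sym => exz.
    have := neighbor_exchange e_sym e_irr P5 ab_sep eab xD yD eax eby exz.
    by case/orP=> [/orP[]|] ->; rewrite ?orbT.
  (* The same argument with [a], [x] and [b], [y] interchanged. *)
  rewrite e_sym => eyz.
  have := neighbor_exchange e_sym e_irr P5 ba_sep eba yD xD eby eax eyz.
  by case/orP=> [/orP[]|] ->; rewrite ?orbT.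
exists (exchange D a b x y).
  by rewrite dominating_exchange ?card_exchange.
apply/proper_card/properP; split.
  by apply/subsetP=> p; rewrite !inE; apply: connect_exchange.
(* The gain is strict: [a] is now in the set, so the edge [a b] connects a pair that was separated
   before. *)
by exists (a, b); rewrite !inE //= connect1 // incident_relE eab !inE eqxx.
Qed.

Lemma connected_incident_dominating (V : finType) (e : rel V) :
    symmetric e -> irreflexive e -> connected e -> P5_free e ->
  exists2 D : {set V}, #|D| = domination_number e & connected (incident_rel e D).
Proof.
move=> e_sym e_irr e_conn P5.
have [D0 dom0 card0] := domination_number_witness e.
(* The inequality suits the exchange, which only bounds the new size from above; for a dominating
   set it amounts to equality. *)
pose P (D : {set V}) := dominating e D && (#|D| <= domination_number e).
have P0 : P D0 by rewrite /P dom0 card0 /=.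
pose m (D : {set V}) := #|connected_pairs (incident_rel e D)|.
have [D] := arg_maxnP m P0; rewrite /m => /andP[domD leD] maxD; exists D.
  by apply/eqP; rewrite eqn_leq leD domination_number_leq.
apply: contraT => /(improve_dominating e_sym e_irr e_conn P5 domD).
case=> D' [domD' leD'] ltD.
have : P D' by rewrite /P domD' (leq_trans leD').
by move=> /maxD/(leq_trans ltD); rewrite ltnn.
Qed.

Theorem theorem2 (V : finType) (e : rel V)
  (e_sym : symmetric e) (e_irr : irreflexive e)
  (V_nontrivial : 1 < #|V|)
  (e_conn : connected e) (e_P5 : P5_free e) :
  domination_number e = tau_ST e.
Proof.
apply/eqP; rewrite eqn_leq domination_leq_tau_ST //=.
have [D <- D_conn] := connected_incident_dominating e_sym e_irr e_conn e_P5.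
exact: tau_ST_leq_incident.
Qed.
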